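(* Let $n,r\ge 1$ be integers, let $P\in\mathbb{F}_2[X]$ be a primitive polynomial of degree $n$, and let $T=(t_{i,j})$ be an $r\times r$ matrix with coefficients in $\mathbb{F}_2[X]/(P)\cong\mathbb{F}_{2^n}$. Let $\mathcal{T}$ be the $rn\times rn$ integer matrix associated to $T$, and let $(a(t),m(t))_{t\ge 0}$ be the sequence of states of the vectorial feedback with carry register (VFCR) with transition matrix $T$, started from an arbitrary initial state $(a(0),m(0))\in\{0,1\}^{rn}\times\mathbb{Z}^{rn}$. For $0\le i\le r-1$ and $0\le j\le n-1$, let $a^i_j(t)\in\{0,1\}$ denote the $j$-th binary component of the $i$-th cell $a_i(t)$. Then for all $0\le i\le r-1$ and $0\le j\le n-1$ the $2$-adic integer $$\sum_{t=0}^{+\infty}a^i_j(t)\,2^t$$ is a rational number of the form $\frac{p_{i,j}}{\tilde q}$ with $p_{i,j}\in\mathbb{Z}$, where $\tilde q=\det(I_{rn}-2\mathcal{T})$.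
   Context: Write $P=X^n+\sum_{k=0}^{n-1}p_kX^k$ over $\mathbb{F}_2$ with $p_k\in\{0,1\}$. $P$ is identified with its canonical lift $X^n-\sum_{k=0}^{n-1}p_kX^k\in\mathbb{Z}[X]$ (for example $X^2-X-1$ for $n=2$), and $\mathbb{Z}[X]/(P)$ is the corresponding free $\mathbb{Z}$-module of rank $n$ with canonical basis $\mathcal{B}=\{1,\bar X,\ldots,\bar X^{n-1}\}$. The canonical lift of $b=b_0+b_1\bar X+\cdots+b_{n-1}\bar X^{n-1}\in\mathbb{F}_2[X]/(P)$ is the element of $\mathbb{Z}[X]/(P)$ with the same coordinates $b_k\in\{0,1\}$, viewed as integers. For $b\in\mathbb{F}_2[X]/(P)$, $M_b$ is the $n\times n$ integer matrix of multiplication by the canonical lift of $b$ on $\mathbb{Z}[X]/(P)$ in the basis $\mathcal{B}$, acting on row vectors: if $c\in\mathbb{Z}[X]/(P)$ has coordinate row vector $(c_0,\ldots,c_{n-1})$, then $cb$ has coordinate row vector $(c_0,\ldots,c_{n-1})M_b$. For an $r\times r$ matrix $T=(t_{i,j})$ over $\mathbb{F}_2[X]/(P)$, the matrix $\mathcal{T}=(M_{t_{i,j}})_{i,j}$ is the $rn\times rn$ integer matrix made of these blocks. A state of the vectorial feedback with carry register (VFCR) of length $r$ with transition matrix $T$ is a pair $(a(t),m(t))$ with $a(t)=(a_0(t),\ldots,a_{r-1}(t))\in(\mathbb{F}_2[X]/(P))^r$ and $m(t)=(m_1(t),\ldots,m_r(t))\in(\mathbb{Z}[X]/(P))^r$.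 Using canonical lifts and coordinates in $\mathcal{B}$, these are written as row vectors of length $rn$: $a(t)=(a_0^0(t),\ldots,a_{n-1}^0(t),\ldots,a_0^{r-1}(t),\ldots,a_{n-1}^{r-1}(t))\in\{0,1\}^{rn}$ and $m(t)=(m_0^1(t),\ldots,m_{n-1}^1(t),\ldots,m_0^{r}(t),\ldots,m_{n-1}^{r}(t))\in\mathbb{Z}^{rn}$. The state change is $$a(t+1)=\big(a(t)\mathcal{T}+m(t)\big)\bmod 2,\qquad m(t+1)=\big(a(t)\mathcal{T}+m(t)\big)\ \mathrm{div}\ 2,$$ computed over $\mathbb{Z}$ and applied componentwise, where for an integer $\sigma$, $\sigma\bmod 2\in\{0,1\}$ and $\sigma\ \mathrm{div}\ 2=\frac12(\sigma-(\sigma\bmod 2))$. *)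

(* Defs.v *)
From HB Require Import structures.
From mathcomp Require Import all_boot all_order all_algebra all_field.
From mathcomp Require Import boolp.

Set Implicit Arguments.
Unset Strict Implicit.
Unset Printing Implicit Defensive.

Import Order.TTheory GRing.Theory Num.Theory.
Local Open Scope ring_scope.

(* Z_2 is the inverse limit of the rings Z/2^k: a 2-adic integer x is given by
   its residues x k modulo 2^k, each one represented in [0, 2^k[. *)

Record Z2 : Type := MkZ2 {
  residue :> nat -> int;
  residue_coherent : forall k, residue k = (residue k.+1 %% 2 ^+ k)%Z
}.

Lemma Z2P (x y : Z2) : x =1 y -> x = y.
Proof.
case: x y => [f hf] [g hg] /= /funext eqfg.
by case: g / eqfg hg => hg; congr MkZ2; exact: Prop_irrelevance.
Qed.

HB.instance Definition _ := gen_eqMixin Z2.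
HB.instance Definition _ := gen_choiceMixin Z2.

Lemma modz_expr_leq (a : int) k l : (k <= l)%N ->
  ((a %% 2 ^+ l)%Z %% 2 ^+ k)%Z = (a %% 2 ^+ k)%Z.
Proof.
move=> kl; rewrite [in RHS](divz_eq a (2 ^+ l)) -(subnK kl) exprD mulrA.
by rewrite modzMDl.
Qed.

Lemma residue_mod (x : Z2) k : (x k %% 2 ^+ k)%Z = x k.
Proof. by rewrite residue_coherent modz_mod. Qed.

Lemma residue_leq (x : Z2) k l : (k <= l)%N -> (x l %% 2 ^+ k)%Z = x k.
Proof.
move=> /subnK <-; elim: (l - k)%N => [|d IH]; first exact: residue_mod.
by rewrite addSn -IH (residue_coherent x (d + k)) modz_expr_leq ?leq_addl.
Qed.

Lemma Z2_of_subproof (f : nat -> int)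
    (hf : forall k, (f k.+1 = f k %[mod 2 ^+ k])%Z) k :
  (f k %% 2 ^+ k)%Z = ((f k.+1 %% 2 ^+ k.+1)%Z %% 2 ^+ k)%Z.
Proof. by rewrite modz_expr_leq // hf. Qed.

Definition Z2_of (f : nat -> int)
    (hf : forall k, (f k.+1 = f k %[mod 2 ^+ k])%Z) : Z2 :=
  MkZ2 (Z2_of_subproof hf).

Lemma Z2_const_proof (a : int) k : (a = a %[mod 2 ^+ k])%Z.
Proof. by []. Qed.

Lemma Z2_opp_proof (x : Z2) k : (- x k.+1 = - x k %[mod 2 ^+ k])%Z.
Proof. by rewrite -modzNm residue_leq. Qed.

Lemma Z2_add_proof (x y : Z2) k :
  (x k.+1 + y k.+1 = x k + y k %[mod 2 ^+ k])%Z.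
Proof. by rewrite -modzDm !residue_leq. Qed.

Lemma Z2_mul_proof (x y : Z2) k :
  (x k.+1 * y k.+1 = x k * y k %[mod 2 ^+ k])%Z.
Proof. by rewrite -modzMm !residue_leq. Qed.

Definition Z2_const (a : int) : Z2 := Z2_of (Z2_const_proof a).
Definition Z2_opp (x : Z2) : Z2 := Z2_of (Z2_opp_proof x).
Definition Z2_add (x y : Z2) : Z2 := Z2_of (Z2_add_proof x y).
Definition Z2_mul (x y : Z2) : Z2 := Z2_of (Z2_mul_proof x y).

Lemma Z2_addA : associative Z2_add.
Proof. by move=> x y z; apply: Z2P => k /=; rewrite modzDml modzDmr addrA. Qed.

Lemma Z2_addC : commutative Z2_add.
Proof. by move=> x y; apply: Z2P => k /=; rewrite addrC. Qed.

Lemma Z2_add0 : left_id (Z2_const 0) Z2_add.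
Proof. by move=> x; apply: Z2P => k /=; rewrite mod0z add0r residue_mod. Qed.

Lemma Z2_addN : left_inverse (Z2_const 0) Z2_opp Z2_add.
Proof. by move=> x; apply: Z2P => k /=; rewrite modzDml addNr. Qed.

HB.instance Definition _ :=
  GRing.isZmodule.Build Z2 Z2_addA Z2_addC Z2_add0 Z2_addN.

Lemma Z2_mulA : associative Z2_mul.
Proof. by move=> x y z; apply: Z2P => k /=; rewrite modzMml modzMmr mulrA. Qed.

Lemma Z2_mulC : commutative Z2_mul.
Proof. by move=> x y; apply: Z2P => k /=; rewrite mulrC. Qed.

Lemma Z2_mul1 : left_id (Z2_const 1) Z2_mul.
Proof. by move=> x; apply: Z2P => k /=; rewrite modzMml mul1r residue_mod. Qed.

Lemma Z2_mulDl : left_distributive Z2_mul Z2_add.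
Proof.
by move=> x y z; apply: Z2P => k /=; rewrite modzMml mulrDl modzDm.
Qed.

Lemma Z2_1_neq0 : Z2_const 1 != 0.
Proof. by apply/eqP => /(congr1 (fun x : Z2 => x 1%N)). Qed.

HB.instance Definition _ := GRing.Zmodule_isComNzRing.Build Z2
  Z2_mulA Z2_mulC Z2_mul1 Z2_mulDl Z2_1_neq0.

Definition Z2_unit : pred Z2 := fun x => `[< exists y, y * x = 1 >].
Definition Z2_inv (x : Z2) : Z2 :=
  if pselect (exists y, y * x = 1) is left h then projT1 (cid h) else x.

Lemma Z2_mulVx : {in Z2_unit, left_inverse 1 Z2_inv *%R}.
Proof.
move=> x /asboolP ux; rewrite /Z2_inv; case: pselect => // h.
by case: cid.
Qed.

Lemma Z2_unitPl (x y : Z2) : y * x = 1 -> Z2_unit x.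
Proof. by move=> yx; apply/asboolP; exists y. Qed.

Lemma Z2_inv_out : {in [predC Z2_unit], Z2_inv =1 id}.
Proof.
by move=> x /asboolP nux; rewrite /Z2_inv; case: pselect.
Qed.

HB.instance Definition _ := GRing.ComNzRing_hasMulInverse.Build Z2
  Z2_mulVx Z2_unitPl Z2_inv_out.

Lemma Z2_neq0P (x : Z2) : x != 0 -> exists k, x k != 0.
Proof.
move=> /eqP x0; apply: contrapT => nx; apply: x0; apply: Z2P => k /=.
by rewrite mod0z; apply/eqP/negPn/negP => xk; apply: nx; exists k.
Qed.

Lemma Z2_dvd_leq (x : Z2) k l : (k <= l)%N -> x k != 0 ->
  ~~ (2 ^ k %| `|x l|)%N.
Proof.
move=> kl; apply: contra; rewrite -(residue_leq x kl) => dvdx.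
by apply/eqP/dvdz_mod0P; rewrite dvdzE abszX.
Qed.

Lemma Z2_mulf_eq0 : GRing.integral_domain_axiom Z2.
Proof.
move=> x y xy0; have [//|x0] := eqVneq x 0; have [//|y0] := eqVneq y 0.
exfalso.
have [a xa] := Z2_neq0P x0; have [b yb] := Z2_neq0P y0.
have := congr1 (fun z : Z2 => z (a + b)%N) xy0.
rewrite /= mod0z => /dvdz_mod0P; rewrite dvdzE abszM abszX.
have := Z2_dvd_leq (leq_addr b a) xa; have := Z2_dvd_leq (leq_addl a b) yb.
set u := `|x _|%N; set v := `|y _|%N.
have [->|u0] := posnP u; first by rewrite dvdn0.
have [->|v0] := posnP v; first by rewrite dvdn0.
rewrite !pfactor_dvdn ?muln_gt0 ?u0 // -!ltnNge lognM // => vb ua.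
by apply/negP; rewrite -ltnNge -addSn leq_add // ltnW.
Qed.

HB.instance Definition _ := GRing.ComUnitRing_isIntegral.Build Z2 Z2_mulf_eq0.

Notation Q2 := {fraction Z2}.

Lemma residueD (x y : Z2) k : (x + y) k = ((x k + y k) %% 2 ^+ k)%Z.
Proof. by []. Qed.

Lemma residueM (x y : Z2) k : (x * y) k = ((x k * y k) %% 2 ^+ k)%Z.
Proof. by []. Qed.

Lemma residue_int (a : int) k : (a%:~R : Z2) k = (a %% 2 ^+ k)%Z.
Proof.
have natP m : (m%:R : Z2) k = (m%:Z %% 2 ^+ k)%Z.
  elim: m => [|m IH] //.
  by rewrite -[m.+1%:R]natr1 residueD IH modzDm intS addrC.
case: a => m; first by rewrite -pmulrn natP.
by rewrite NegzE mulrNz -pmulrn /= natP modzNm.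
Qed.

Lemma Z2_series_proof (c : nat -> int) k :
  (\sum_(t < k.+1) c t * 2 ^+ t = \sum_(t < k) c t * 2 ^+ t %[mod 2 ^+ k])%Z.
Proof. by rewrite big_ord_recr /= -modzDmr modzMl addr0. Qed.

(* The sum of the series \sum_t c_t 2^t: modulo 2^k only the terms of index
   t < k contribute. *)
Definition Z2_series (c : nat -> int) : Z2 := Z2_of (Z2_series_proof c).

(* The partial sums computed in Z_2 converge to Z2_series c for the 2-adic
   (inverse limit) topology. *)
Lemma Z2_series_cvg (c : nat -> int) k : exists N, forall m, (N <= m)%N ->
  (\sum_(t < m) (c t)%:~R * 2 ^+ t : Z2) k = Z2_series c k.
Proof.
exists k => m km.
have -> : (\sum_(t < m) (c t)%:~R * 2 ^+ t : Z2)
    = (\sum_(t < m) c t * 2 ^+ t)%:~R.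
  by rewrite rmorph_sum; apply: eq_bigr => t _; rewrite rmorphM rmorphXn.
rewrite residue_int /= -(subnKC km) big_split_ord /=.
have -> : \sum_(t < m - k) c (k + t)%N * 2 ^+ (k + t)
    = (\sum_(t < m - k) c (k + t)%N * 2 ^+ t) * 2 ^+ k.
  by rewrite mulr_suml; apply: eq_bigr => t _; rewrite addnC exprD mulrA.
by rewrite addrC modzMDl.
Qed.

Lemma Z2_cvg_unique (u : nat -> Z2) (x y : Z2) :
  (forall k, exists N, forall m, (N <= m)%N -> u m k = x k) ->
  (forall k, exists N, forall m, (N <= m)%N -> u m k = y k) -> x = y.
Proof.
move=> ux uy; apply: Z2P => k.
have [N hN] := ux k; have [N' hN'] := uy k.
by rewrite -(hN (maxn N N')) ?leq_maxl // hN' ?leq_maxr.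
Qed.

Definition bit_lift (b : 'F_2) : int := (b : nat)%:Z.

Definition poly_lift (n : nat) (P : {poly 'F_2}) : {poly int} :=
  'X^n - \sum_(k < n) bit_lift P`_k *: 'X^k.

(* The ring {poly %/ h} is the quotient by h only when h is monic of positive
   degree; poly_lift n P is so as soon as n > 0. *)
Definition elt_lift (n : nat) (P : {poly 'F_2}) (b : {poly %/ P}) :
    {poly %/ poly_lift n P} :=
  in_qpoly (poly_lift n P) (map_poly bit_lift b).

Definition coords (n : nat) (P : {poly 'F_2}) (c : {poly %/ poly_lift n P}) :
    'rV[int]_n :=
  \row_(j < n) c`_j.

Definition mul_mx (n : nat) (P : {poly 'F_2}) (b : {poly %/ P}) : 'M[int]_n :=
  \matrix_(i < n) coords ('qX ^+ i * elt_lift n b).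

Definition block_lift (n r : nat) (P : {poly 'F_2})
    (T : 'M[{poly %/ P}]_r) : 'M[int]_(\sum_(i < r) n) :=
  \mxblock_(i < r, j < r) mul_mx n (T i j).

Definition vfcr_state (n r : nat) (P : {poly 'F_2}) : Type :=
  ('rV[{poly %/ P}]_r * 'rV[{poly %/ poly_lift n P}]_r)%type.

Definition cells_row (n r : nat) (P : {poly 'F_2}) (s : vfcr_state n r P) :
    'rV[int]_(\sum_(i < r) n) :=
  \mxrow_(i < r) coords (elt_lift n (s.1 0 i)).

Definition carry_row (n r : nat) (P : {poly 'F_2}) (s : vfcr_state n r P) :
    'rV[int]_(\sum_(i < r) n) :=
  \mxrow_(i < r) coords (s.2 0 i).

Definition vfcr_sigma (n r : nat) (P : {poly 'F_2}) (T : 'M[{poly %/ P}]_r)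
    (s : vfcr_state n r P) : 'rV[int]_(\sum_(i < r) n) :=
  cells_row s *m block_lift n T + carry_row s.

Definition mod2 (x : int) : int := (x %% 2)%Z.
Definition div2 (x : int) : int := (x %/ 2)%Z.

Definition vfcr_step (n r : nat) (P : {poly 'F_2}) (T : 'M[{poly %/ P}]_r)
    (s : vfcr_state n r P) : vfcr_state n r P :=
  let sigma := vfcr_sigma T s in
  (\row_(i < r) in_qpoly P
     (rVpoly (map_mx (fun x => (mod2 x)%:~R : 'F_2) (submxrow sigma i))),
   \row_(i < r) in_qpoly (poly_lift n P)
     (rVpoly (map_mx div2 (submxrow sigma i)))).

Definition vfcr (n r : nat) (P : {poly 'F_2}) (T : 'M[{poly %/ P}]_r)
    (s0 : vfcr_state n r P) (t : nat) : vfcr_state n r P :=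
  iter t (vfcr_step T) s0.

Definition cell_bit (n r : nat) (P : {poly 'F_2}) (s : vfcr_state n r P)
    (i : 'I_r) (j : 'I_n) : int :=
  bit_lift (s.1 0 i)`_j.

Lemma div2E (x : int) : 2 * div2 x = x - mod2 x.
Proof. by rewrite {2}(divz_eq x 2) /div2 /mod2 addrK mulrC. Qed.

Lemma size_poly_lift n P : size (poly_lift n P) = n.+1.
Proof.
rewrite /poly_lift size_polyDl size_polyXn // size_polyN ltnS.
apply: (leq_trans (size_sum _ _ _)); apply/bigmax_leqP => k _.
by rewrite (leq_trans (size_scale_leq _ _)) // size_polyXn.
Qed.

Lemma monic_poly_lift n P : poly_lift n P \is monic.
Proof.
rewrite monicE lead_coefE size_poly_lift /= coefB coefXn eqxx coef_sum.
rewrite big1 ?subr0 // => k _.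
by rewrite coefZ coefXn gtn_eqF ?mulr0.
Qed.

Section Coherence.
Variables (n r : nat) (P : {poly 'F_2}).
Hypotheses (n_gt0 : (0 < n)%N) (sizeP : size P = n.+1).

Lemma mk_monic_poly_lift : mk_monic (poly_lift n P) = poly_lift n P.
Proof. by rewrite /mk_monic size_poly_lift ltnS n_gt0 monic_poly_lift. Qed.

Lemma mk_monic_P : mk_monic P = P.
Proof.
rewrite /mk_monic sizeP ltnS n_gt0 /= monicE.
have : lead_coef P != 0 by rewrite lead_coef_eq0 -size_poly_eq0 sizeP.
by case: (lead_coef P) => [[|[|m]] hm] // _; rewrite (_ : Ordinal hm == 1).
Qed.

Lemma size_qpoly (b : {poly %/ P}) : (size b <= n)%N.
Proof. by have := size_npoly b; rewrite {2}mk_monic_P sizeP. Qed.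

Lemma size_qpoly_lift (c : {poly %/ poly_lift n P}) : (size c <= n)%N.
Proof. by have := size_npoly c; rewrite {2}mk_monic_poly_lift size_poly_lift. Qed.

Lemma elt_lift_coef (b : {poly %/ P}) k : (elt_lift n b)`_k = bit_lift b`_k.
Proof.
rewrite /elt_lift /= Pdiv.Ring.rmodp_small; first by rewrite coef_map_id0.
rewrite mk_monic_poly_lift size_poly_lift ltnS.
by rewrite (leq_trans (size_poly _ _)) ?size_qpoly.
Qed.

Lemma mul_mxP (c : {poly %/ poly_lift n P}) (b : {poly %/ P}) :
  coords c *m mul_mx n b = coords (c * elt_lift n b).
Proof.
have hc : c = \sum_(k < n) c`_k *: 'qX ^+ k.
  have {1}-> : c = in_qpoly (poly_lift n P) c.
    by apply: val_inj; rewrite /= Pdiv.Ring.rmodp_small // size_mk_monic.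
  have {1}-> : polyn c = \sum_(k < n) c`_k *: 'X^k.
    rewrite -poly_def; apply/polyP => i; rewrite coef_poly.
    by case: ltnP => // ni; rewrite nth_default // (leq_trans _ ni) ?size_qpoly_lift.
  by rewrite linear_sum; apply: eq_bigr => k _; rewrite linearZ /= rmorphXn.
apply/rowP => j; rewrite !mxE [in RHS]hc mulr_suml coefn_sum.
by apply: eq_bigr => k _; rewrite !mxE -scalerAl coefZ.
Qed.

Lemma cells_row_step (T : 'M[{poly %/ P}]_r) (s : vfcr_state n r P) :
  cells_row (vfcr_step T s) = map_mx mod2 (vfcr_sigma T s).
Proof.
apply/mxrowP => i; rewrite mxrowK; apply/rowP => j.
rewrite !mxE elt_lift_coef /= Pdiv.Ring.rmodp_small; last first.
  by rewrite mk_monic_P sizeP ltnS size_poly.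
rewrite coef_rVpoly_ord !mxE /mod2 /bit_lift.
set x := (_ + _ : int).
have : (x %% 2)%Z \in [:: 0; 1].
  have := modz_ge0 x (isT : 2 != 0 :> int).
  have := ltz_pmod x (isT : 0 < 2 :> int).
  by case: (x %% 2)%Z => [[|[|m]]|m].
by rewrite !inE => /orP[] /eqP ->.
Qed.

Lemma carry_row_step (T : 'M[{poly %/ P}]_r) (s : vfcr_state n r P) :
  carry_row (vfcr_step T s) = map_mx div2 (vfcr_sigma T s).
Proof.
apply/mxrowP => i; rewrite mxrowK; apply/rowP => j.
rewrite !mxE /= Pdiv.Ring.rmodp_small; last first.
  by rewrite mk_monic_poly_lift size_poly_lift ltnS size_poly.
by rewrite coef_rVpoly_ord !mxE.
Qed.

Lemma cells_carry_surj (a : 'rV[bool]_(\sum_(i < r) n))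
    (m : 'rV[int]_(\sum_(i < r) n)) :
  exists s : vfcr_state n r P,
    cells_row s = map_mx (fun b : bool => b%:Z) a /\ carry_row s = m.
Proof.
exists (\row_(i < r) in_qpoly P
          (rVpoly (map_mx (fun b : bool => b%:R : 'F_2) (submxrow a i))),
        \row_(i < r) in_qpoly (poly_lift n P) (rVpoly (submxrow m i))).
split; apply/mxrowP => i; rewrite mxrowK; apply/rowP => j.
  rewrite !mxE elt_lift_coef /= Pdiv.Ring.rmodp_small; last first.
    by rewrite mk_monic_P sizeP ltnS size_poly.
  by rewrite coef_rVpoly_ord !mxE; case: (a _ _).
rewrite !mxE /= Pdiv.Ring.rmodp_small; last first.
  by rewrite mk_monic_poly_lift size_poly_lift ltnS size_poly.
by rewrite coef_rVpoly_ord !mxE.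
Qed.
End Coherence.

(* Main.v *)
Require Import Defs.
From mathcomp Require Import all_boot all_order all_algebra all_field.
From mathcomp Require Import ring.

Import Order.TTheory GRing.Theory Num.Theory.
Local Open Scope ring_scope.

(** Let A be the integer matrix of T and c(t), m(t) the cell and carry rows.
    Since c(t+1) + 2 m(t+1) = c(t) A + m(t), the truncated series
    S_k = \sum_(t < k) 2^t c(t) satisfies, by telescoping,
    S_k (I - 2A) = c(0) + 2 m(0) - 2^k (c(k) + 2 m(k)).
    Multiplying by the adjugate of I - 2A gives q S_k = w modulo 2^k for a
    fixed integer vector w, i.e. q S = w over the 2-adic integers; q is odd,
    hence nonzero. *)

(** Reduction modulo 2 turns the matrix into the identity, so the determinant is odd. *)
Lemma det_1sub2_neq0 N (A : 'M[int]_N) : \det (1%:M - 2 *: A) != 0.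
Proof.
apply/eqP => /(congr1 (fun x : int => x%:~R : 'F_2)) /eqP.
rewrite -det_map_mx map_mxB map_mxZ map_mx1.
have two0 : ((2 : int)%:~R : 'F_2) = 0 by apply/eqP.
by rewrite [X in X *: _]two0 scale0r subr0 det1 oner_eq0.
Qed.

Lemma Z2_intr_eq0 (a : int) : ((a%:~R : Z2) == 0) = (a == 0).
Proof.
apply/eqP/eqP => [a0|->] //; apply/eqP; rewrite -absz_eq0.
(* The residue of index [|a|] suffices: a nonzero a is not divisible by 2^|a|, which exceeds |a|. *)
have := congr1 (fun x : Z2 => x `|a|%N) a0.
rewrite residue_int /= mod0z => /dvdz_mod0P; rewrite dvdzE abszX.
apply: contraTT; rewrite -lt0n => a_gt0.
by rewrite (gtnNdvd a_gt0 (ltn_expl _ _)).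
Qed.

Lemma Q2_intr_eq0 (a : int) : ((a%:~R : Q2) == 0) = (a == 0).
Proof. by rewrite -(rmorph_int (@tofrac Z2)) tofrac_eq0 Z2_intr_eq0. Qed.

(** [ratr] uses the reduced fraction; cross-multiplying compares it with p/q, since nonzero integers
    stay nonzero in [Q2]. *)
Lemma Q2_ratr_frac (p q : int) : q != 0 ->
  ratr (p%:Q / q%:Q) = p%:~R / q%:~R :> Q2.
Proof.
move=> q0; set x : rat := p%:Q / q%:Q; rewrite /ratr.
apply/eqP; rewrite eqr_div ?Q2_intr_eq0 ?denq_neq0 // -!intrM.
apply/eqP; congr (_%:~R); apply: (@intr_inj rat).
have xq : x * q%:Q = p%:Q by rewrite /x divfK // intr_eq0.
have dx : (denq x)%:Q != 0 by rewrite intr_eq0 denq_neq0.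
by rewrite !intrM -xq -{2}[x]divq_num_den mulrAC divfK.
Qed.

(** The residue of index k sees only the first k terms, and the error [z k * 2 ^+ k] vanishes
    there. *)
Lemma Z2_series_mul_int (c : nat -> int) (q w : int) (z : nat -> int) :
  (forall k, q * (\sum_(t < k) c t * 2 ^+ t) = w + z k * 2 ^+ k) ->
  q%:~R * Z2_series c = w%:~R :> Z2.
Proof.
move=> qc; apply: Z2P => k.
by rewrite residueM !residue_int /= modzMml modzMmr qc addrC modzMDl.
Qed.

Section Vfcr.
Variables (n r : nat) (P : {poly 'F_2}) (T : 'M[{poly %/ P}]_r).
Hypotheses (n_gt0 : (0 < n)%N) (sizeP : size P = n.+1).

Lemma cells_row_Rank (s : vfcr_state n r P) i j :
  cells_row s 0 (tagnat.Rank i j) = cell_bit s i j.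
Proof.
have := congr1 (fun v : 'rV_n => v 0 j)
  (mxrowK (fun i => coords (elt_lift n (s.1 0 i))) i).
by rewrite [LHS]mxE [RHS]mxE elt_lift_coef.
Qed.

(** Remainder plus twice the quotient recovers the number divided by 2. *)
Lemma vfcr_step_sigma (s : vfcr_state n r P) :
  cells_row (vfcr_step T s) + 2 *: carry_row (vfcr_step T s)
    = cells_row s *m block_lift n T + carry_row s.
Proof.
rewrite cells_row_step // carry_row_step // -/(vfcr_sigma T s).
apply/rowP => l; move: (vfcr_sigma T s) => u.
by rewrite !mxE div2E addrC subrK.
Qed.

Lemma vfcr_partial_sum (s0 : vfcr_state n r P) k :
  (\sum_(t < k) 2 ^+ t *: cells_row (vfcr T s0 t))
      *m (1%:M - 2 *: block_lift n T)
    = cells_row s0 + 2 *: carry_row s0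
      - 2 ^+ k *: (cells_row (vfcr T s0 k) + 2 *: carry_row (vfcr T s0 k)).
Proof.
elim: k => [|k IH]; first by rewrite big_ord0 mul0mx expr0 scale1r subrr.
(* With the notation above, 2^k c(k) (I - 2A) - 2^k (c(k) + 2 m(k)) = - 2^(k+1) (c(k) A + m(k)). *)
rewrite big_ord_recr mulmxDl IH /= vfcr_step_sigma.
rewrite mulmxBr mulmx1 -scalemxAl -scalemxAr.
apply/rowP => l; rewrite !mxE exprS; ring.
Qed.

End Vfcr.

Theorem theorem1p2 (n r : nat) (P : {poly 'F_2}) (T : 'M[{poly %/ P}]_r)
    (s0 : vfcr_state n r P) (hn : (1 <= n)%N) (hr : (1 <= r)%N)
    (sizeP : size P = n.+1) (primP : primitive_poly P) :
  let q : int := \det (1%:M - 2 *: block_lift n T) in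
  q != 0 /\
  forall (i : 'I_r) (j : 'I_n), exists p : int,
    tofrac (Z2_series (fun t => cell_bit (vfcr T s0 t) i j))
      = ratr (p%:Q / q%:Q) :> Q2.
Proof.
move=> q; have q0 : q != 0 by exact: det_1sub2_neq0.
split=> // i j; set B := 1%:M - _ in q q0 *; set l := tagnat.Rank i j.
(* [full 0] is the vector w, whose entry [l] is the numerator; [- full k] is the coefficient of 2^k
   in the error. *)
pose full k : 'rV_(\sum_(i < r) n) :=
  (cells_row (vfcr T s0 k) + 2 *: carry_row (vfcr T s0 k)) *m \adj B.
exists (full 0%N 0 l); rewrite Q2_ratr_frac //.
apply: (canRL (mulfK _)); first by rewrite Q2_intr_eq0.
rewrite mulrC -!(rmorph_int (@tofrac Z2)) -rmorphM; congr tofrac.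
apply: (Z2_series_mul_int _ _ _ (fun k => - full k 0 l)) => k.
have := congr1 (fun v => (v *m \adj B) 0 l)
  (vfcr_partial_sum _ _ _ T hn sizeP s0 k).
rewrite -mulmxA mul_mx_adj mul_mx_scalar mulmxBl -scalemxAl.
rewrite -/(full k) -/(full 0%N); move: (full) => u.
rewrite !mxE summxE -/q mulNr [u k 0 l * _]mulrC => <-.
congr (_ * _); apply: eq_bigr => t _.
by rewrite mxE cells_row_Rank // mulrC.
Qed.
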